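(* Let $R$ be a Leibniz conformal algebra, $H$ a $\mathbb C[\partial]$-module (viewed as a Leibniz conformal algebra with zero bracket) and $\mathcal E:0\to H\xrightarrow{\alpha}E\xrightarrow{p}R\to0$ an abelian extension of $R$ by $H$ with a section $s$. Then the sequence $$1\to\mathrm{Aut}^{\mathrm{id}}_H(E)\xrightarrow{\iota}\mathrm{Aut}_H(E)\xrightarrow{\bar\kappa}\mathrm{Aut}_\bullet(H,R)\xrightarrow{\bar{\mathcal W}}H^2(R,H)$$ is exact, where $\iota$ is the inclusion map.
   Context: All vector spaces are over $\mathbb C$ and all $\mathbb C[\partial]$-modules are finitely generated. A Leibniz conformal algebra is a $\mathbb C[\partial]$-module $R$ with a $\mathbb C$-bilinear $\lambda$-bracket $R\times R\to R[\lambda]$, $(a,b)\mapsto[a_\lambda b]$, such that $[(\partial a)_\lambda b]=-\lambda[a_\lambda b]$, $[a_\lambda\partial b]=(\partial+\lambda)[a_\lambda b]$ and $[a_\lambda[b_\mu c]]=[[a_\lambda b]_{\lambda+\mu}c]+[b_\mu[a_\lambda c]]$. Homomorphisms are $\mathbb C[\partial]$-linear maps preserving $\lambda$-brackets. An abelian extension of $R$ by $H$ is a short exact sequence $0\to H\xrightarrow{\alpha}E\xrightarrow{p}R\to0$ of Leibniz conformal algebras and homomorphisms, where $H$ has zero bracket ($H$ is identified with $\alpha(H)$). A section is a $\mathbb C[\partial]$-module homomorphism $s:R\to E$ with $p\circ s=\mathrm{id}_R$. The induced $R$-module structure on $H$ (independent of $s$) is $a\triangleright_\lambda h=[s(a)_\lambda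 h]$, $h\triangleleft_\lambda a=[h_\lambda s(a)]$, and the induced $2$-cocycle is $\chi_\lambda(a,b)=[s(a)_\lambda s(b)]-s([a_\lambda b])$. $C^1(R,H)$ is the space of $\mathbb C[\partial]$-module homomorphisms $R\to H$, and $C^2(R,H)$ is the space of $\mathbb C$-bilinear maps $f_\lambda:R\times R\to H[\lambda]$ with $f_\lambda(\partial a,b)=-\lambda f_\lambda(a,b)$, $f_\lambda(a,\partial b)=(\partial+\lambda)f_\lambda(a,b)$. For $\beta\in C^1(R,H)$, $(\delta\beta)_\lambda(a,b)=a\triangleright_\lambda\beta(b)+\beta(a)\triangleleft_\lambda b-\beta([a_\lambda b])$; for $f\in C^2(R,H)$, $(\delta f)_{\lambda,\mu}(a,b,c)=a\triangleright_\lambda f_\mu(b,c)-b\triangleright_\mu f_\lambda(a,c)-f_\lambda(a,b)\triangleleft_{\lambda+\mu}c-f_{\lambda+\mu}([a_\lambda b],c)-f_\mu(b,[a_\lambda c])+f_\lambda(a,[b_\mu c])$. $Z^2(R,H)=\{f\in C^2(R,H):\delta f=0\}$ and $H^2(R,H)=Z^2(R,H)/\delta C^1(R,H)$. $\mathrm{Aut}(H)$ is the group of $\mathbb C[\partial]$-module automorphisms of $H$, $\mathrm{Aut}(R),\mathrm{Aut}(E)$ are the groups of Leibniz conformal algebra automorphisms. $\mathrm{Aut}_\bullet(H,R)$ is the set of pairs $(\gamma,\varphi)\in\mathrm{Aut}(H)\times\mathrm{Aut}(R)$ with $\gamma(a\triangleright_\lambda h)=\varphi(a)\triangleright_\lambda\gamma(h)$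 and $\gamma(h\triangleleft_\lambda a)=\gamma(h)\triangleleft_\lambda\varphi(a)$ for all $a\in R$, $h\in H$. For such a pair, $\chi^{\gamma,\varphi}_\lambda(a,b)=\gamma(\chi_\lambda(\varphi^{-1}(a),\varphi^{-1}(b)))$ lies in $Z^2(R,H)$, and $\bar{\mathcal W}(\gamma,\varphi)=[\chi^{\gamma,\varphi}-\chi]\in H^2(R,H)$. $\mathrm{Aut}_H(E)=\{f\in\mathrm{Aut}(E)\mid f(H)=H\}$; for $f\in\mathrm{Aut}_H(E)$, $\hat f=p\circ f\circ s$ and $\bar\kappa(f)=(f|_H,\hat f)$, a group homomorphism into $\mathrm{Aut}_\bullet(H,R)$. $\mathrm{Aut}^{\mathrm{id}}_H(E)=\{f\in\mathrm{Aut}_H(E)\mid f|_H=\mathrm{id}_H,\ \hat f=\mathrm{id}_R\}$. Exactness at $\mathrm{Aut}_\bullet(H,R)$ means $\mathrm{Im}(\bar\kappa)=\bar{\mathcal W}^{-1}(0)$ ($\bar{\mathcal W}$ is a map of sets). *)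

(* Defs.v *)
From HB Require Import structures.
From mathcomp Require Import all_boot all_order all_algebra.
From mathcomp Require Import finmap boolp classical_sets functions reals.
From mathcomp Require Import complex monalg.

Set Implicit Arguments.
Unset Strict Implicit.
Unset Printing Implicit Defensive.

Import GRing.Theory.

Local Open Scope ring_scope.
Local Open Scope classical_set_scope.
Local Open Scope quotient_scope.

(* V[lambda] and V[lambda, mu]: the coefficient of lambda^n is u@_n, that of
   lambda^i mu^j is w@_(i, j). *)
Notation lpoly V := {malg V[nat]}.
Notation lmpoly V := {malg V[(nat * nat)%type]}.

Section Polynomials.

Definition mfold (K : choiceType) (V W : zmodType) (F : K -> V -> W)
    (u : {malg V[K]}) : W :=
  \sum_(k <- msupp u) F k u@_k.

Definition mshift (K : choiceType) (V : zmodType) (g : K -> K)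
    (u : {malg V[K]}) : {malg V[K]} :=
  mfold (fun k x => << x *g g k >>) u.

Definition cmap (K : choiceType) (V W : zmodType) (phi : V -> W)
    (u : {malg V[K]}) : {malg W[K]} :=
  mfold (fun k x => << phi x *g k >>) u.

Definition mul_lambda {V : zmodType} (u : lpoly V) : lpoly V :=
  mshift S u.

Definition lambda {V : zmodType} (w : lmpoly V) :
    lmpoly V :=
  mshift (fun k => (k.1.+1, k.2)) w.

Definition mu {V : zmodType} (w : lmpoly V) :
    lmpoly V :=
  mshift (fun k => (k.1, k.2.+1)) w.

Definition lambda_mu {V : zmodType} (w : lmpoly V) :
    lmpoly V :=
  lambda w + mu w.

(* u(T) for u in V[lambda], where T stands for lambda, mu or lambda + mu,
   given by its multiplication operator on V[lambda, mu] *)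
Definition msubst (V : zmodType)
    (T : lmpoly V -> lmpoly V) (u : lpoly V) :
    lmpoly V :=
  mfold (fun n x => iter n T << x *g (0, 0)%N >>) u.

(* F_T(u_S) : for u = \sum_j x_j S^j, the polynomial \sum_j S^j F_T(x_j).
   Thus f_lambda(a, g_mu(b, c)) is  mcomp lambda (f a) mu (g b c)  and
   f_(lambda+mu)(g_lambda(a, b), c) is
   mcomp lambda_mu (f^~ c) lambda (g a b). *)
Definition mcomp (U V : zmodType)
    (T : lmpoly V -> lmpoly V)
    (F : U -> lpoly V)
    (S : lmpoly V -> lmpoly V)
    (u : lpoly U) : lmpoly V :=
  mfold (fun j x => iter j S (msubst T (F x))) u.

End Polynomials.

Section PolynomialTheory.

Section Fold.
Variables (K : choiceType) (V W : zmodType).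
Implicit Types (F G : K -> V -> W) (u v : {malg V[K]}).

Lemma zmorph0 (A B : zmodType) (f : A -> B) : zmod_morphism f -> f 0 = 0.
Proof. by move=> fB; rewrite -[X in f X](subrr 0) fB subrr. Qed.

Lemma zmorphN (A B : zmodType) (f : A -> B) :
  zmod_morphism f -> {morph f : x / - x}.
Proof. by move=> fB x; rewrite -[- x]add0r fB zmorph0 // add0r. Qed.

Lemma zmorphD (A B : zmodType) (f : A -> B) :
  zmod_morphism f -> {morph f : x y / x + y}.
Proof. by move=> fB x y; rewrite -{1}[y]opprK fB (zmorphN fB) opprK. Qed.

Lemma zmorph_sum (A B : zmodType) (f : A -> B) I (r : seq I) (E : I -> A) :
  zmod_morphism f -> f (\sum_(i <- r) E i) = \sum_(i <- r) f (E i).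
Proof.
by move=> fB; apply: (big_morph f (zmorphD fB) (zmorph0 fB)).
Qed.

Lemma mfoldEw F u (d : {fset K}) :
  (forall k, F k 0 = 0) -> fsubset (msupp u) d ->
  mfold F u = \sum_(k <- d) F k u@_k.
Proof.
move=> F0 sud; rewrite /mfold; apply: big_fset_incl => // k _ kNu.
by rewrite mcoeff_outdom.
Qed.

Lemma mfoldB F : (forall k, zmod_morphism (F k)) -> zmod_morphism (mfold F).
Proof.
move=> FB u v; have F0 k : F k 0 = 0 by apply: zmorph0.
pose d := (msupp u `|` msupp v)%fset.
rewrite !(@mfoldEw F _ d) ?fsubsetUl ?fsubsetUr ?msuppB_le //.
by rewrite -sumrB; apply: eq_bigr => k _; rewrite mcoeffB FB.
Qed.

Lemma mfoldU F k x : F k 0 = 0 -> mfold F << x *g k >> = F k x.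
Proof.
move=> F0; rewrite /mfold msuppU; case: eqP => [->|_].
  by rewrite big_seq_fset0 F0.
by rewrite big_seq_fset1 mcoeffUU.
Qed.

Lemma eq_mfold F G u : (forall k x, F k x = G k x) -> mfold F u = mfold G u.
Proof. by move=> FG; apply: eq_bigr => k _; rewrite FG. Qed.

Lemma mfold_morph (X : zmodType) (f : W -> X) F u :
  zmod_morphism f -> f (mfold F u) = mfold (fun k x => f (F k x)) u.
Proof. by move=> fB; rewrite /mfold zmorph_sum. Qed.

Lemma mfoldBl F G u :
  mfold (fun k x => F k x - G k x) u = mfold F u - mfold G u.
Proof. by rewrite /mfold sumrB. Qed.

End Fold.

Section Coefs.
Variables (K : choiceType) (V W : zmodType).

Lemma cmapE (phi : V -> W) (u : {malg V[K]}) k :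
  phi 0 = 0 -> (cmap phi u)@_k = phi u@_k.
Proof.
move=> phi0; rewrite /cmap mfold_morph; last exact: mcoeffB.
rewrite (@mfoldEw _ _ _ _ _ (msupp u `|` [fset k])%fset) ?fsubsetUl //; last first.
  by move=> j; rewrite phi0 raddf0 mcoeff0.
rewrite (big_fsetD1 k) /= ?in_fsetU ?in_fset1 ?eqxx ?orbT //.
rewrite mcoeffUU big1_fset ?addr0 // => j.
by rewrite in_fsetD1 mcoeffU; case: eqP.
Qed.

Lemma cmapB (phi : V -> W) :
  zmod_morphism phi -> zmod_morphism (@cmap K V W phi).
Proof.
move=> phiB; apply: mfoldB => k x y.
by rewrite phiB raddfB.
Qed.

Lemma cmapU (phi : V -> W) x (k : K) :
  phi 0 = 0 -> cmap phi << x *g k >> = << phi x *g k >>.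
Proof. by move=> phi0; rewrite /cmap mfoldU ?phi0 ?raddf0. Qed.

Lemma eq_cmap (phi psi : V -> W) (u : {malg V[K]}) :
  phi =1 psi -> cmap phi u = cmap psi u.
Proof. by move=> e; apply: eq_mfold => k x; rewrite e. Qed.

Lemma cmap_inj (phi : V -> W) :
  phi 0 = 0 -> injective phi -> injective (@cmap K V W phi).
Proof.
move=> phi0 phiI u v /malgP uv; apply/malgP => k.
by apply: phiI; rewrite -!cmapE.
Qed.

End Coefs.

Lemma cmap_id (K : choiceType) (V : zmodType) (u : {malg V[K]}) :
  cmap id u = u.
Proof. by apply/malgP => k; rewrite cmapE. Qed.

Lemma cmap_comp (K : choiceType) (U V W : zmodType) (phi : V -> W)
    (psi : U -> V) (u : {malg U[K]}) :
  phi 0 = 0 -> psi 0 = 0 -> cmap phi (cmap psi u) = cmap (phi \o psi) u.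
Proof. by move=> p0 q0; apply/malgP => k; rewrite !cmapE //= q0. Qed.

Lemma mfold_cmap (K : choiceType) (U V W : zmodType) (F : K -> V -> W)
    (phi : U -> V) (u : {malg U[K]}) :
    (forall k, F k 0 = 0) -> phi 0 = 0 ->
  mfold F (cmap phi u) = mfold (fun k x => F k (phi x)) u.
Proof.
move=> F0 p0; have sub : fsubset (msupp (cmap phi u)) (msupp u).
  apply/fsubsetP => k; rewrite -!mcoeff_neq0 cmapE //.
  by apply: contra_neq => ->.
by rewrite (mfoldEw F0 sub) /mfold; apply: eq_bigr => k _; rewrite cmapE.
Qed.

Lemma mshiftB (K : choiceType) (V : zmodType) (g : K -> K) :
  zmod_morphism (@mshift K V g).
Proof. by apply: mfoldB => k x y; rewrite raddfB. Qed.

Lemma cmap_mshift (K : choiceType) (V W : zmodType) (phi : V -> W) g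
    (u : {malg V[K]}) :
  zmod_morphism phi -> cmap phi (mshift g u) = mshift g (cmap phi u).
Proof.
move=> phiB; have phi0 := zmorph0 phiB.
rewrite /mshift mfold_morph; last exact: cmapB.
rewrite mfold_cmap //; last by move=> k; rewrite raddf0.
by apply: eq_mfold => k x; rewrite cmapU.
Qed.

Lemma mul_lambdaB (V : zmodType) : zmod_morphism (@mul_lambda V).
Proof. exact: mshiftB. Qed.

Lemma cmap_mul_lambda (V W : zmodType) (phi : V -> W) u :
  zmod_morphism phi -> cmap phi (mul_lambda u) = mul_lambda (cmap phi u).
Proof. exact: cmap_mshift. Qed.

Lemma lambdaB {V : zmodType} : zmod_morphism (@lambda V).
Proof. exact: mshiftB. Qed.

Lemma cmap_lambda (V W : zmodType) (phi : V -> W) u :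
  zmod_morphism phi -> cmap phi (lambda u) = lambda (cmap phi u).
Proof. exact: cmap_mshift. Qed.

Lemma muB {V : zmodType} : zmod_morphism (@mu V).
Proof. exact: mshiftB. Qed.

Lemma cmap_mu (V W : zmodType) (phi : V -> W) u :
  zmod_morphism phi -> cmap phi (mu u) = mu (cmap phi u).
Proof. exact: cmap_mshift. Qed.

Lemma lambda_muB {V : zmodType} : zmod_morphism (@lambda_mu V).
Proof.
by move=> x y; rewrite /lambda_mu lambdaB muB opprD !addrA; congr (_ + _);
  rewrite addrAC.
Qed.

Lemma cmap_lambda_mu (V W : zmodType) (phi : V -> W) u :
  zmod_morphism phi -> cmap phi (lambda_mu u) = lambda_mu (cmap phi u).
Proof.
move=> phiB; rewrite /lambda_mu (zmorphD (cmapB phiB)).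
by rewrite cmap_lambda // cmap_mu.
Qed.

Lemma iterB (A : zmodType) (T : A -> A) n :
  zmod_morphism T -> zmod_morphism (iter n T).
Proof. by move=> TB; elim: n => [//|n IH] x y /=; rewrite IH TB. Qed.

Lemma iter_morph (A B : Type) (f : A -> B) (T : A -> A) (T' : B -> B) n x :
  (forall y, f (T y) = T' (f y)) -> f (iter n T x) = iter n T' (f x).
Proof. by move=> fT; elim: n => [//|n IH] /=; rewrite fT IH. Qed.

Lemma msubstB (V : zmodType) (T : lmpoly V -> lmpoly V) :
  zmod_morphism T -> zmod_morphism (msubst T).
Proof. by move=> TB; apply: mfoldB => k x y; rewrite raddfB iterB. Qed.

Lemma cmap_msubst (V W : zmodType) (phi : V -> W)
    (T : lmpoly V -> lmpoly V)
    (T' : lmpoly W -> lmpoly W) u :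
    zmod_morphism phi -> zmod_morphism T' ->
    (forall w, cmap phi (T w) = T' (cmap phi w)) ->
  cmap phi (msubst T u) = msubst T' (cmap phi u).
Proof.
move=> phiB TB phiT; have phi0 := zmorph0 phiB.
rewrite /msubst mfold_morph; last exact: cmapB.
rewrite mfold_cmap //; last first.
  by move=> k; rewrite raddf0 (zmorph0 (iterB k TB)).
by apply: eq_mfold => k x; rewrite (iter_morph _ _ phiT) cmapU.
Qed.

Section Mcomp.
Variables (U V : zmodType) (T S : lmpoly V -> lmpoly V).
Hypotheses (TB : zmod_morphism T) (SB : zmod_morphism S).
Implicit Types (F G : U -> lpoly V) (u v : lpoly U).

Lemma mcompB F : zmod_morphism F -> zmod_morphism (mcomp T F S).
Proof.
by move=> FB; apply: mfoldB => k x y; rewrite FB msubstB // iterB.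
Qed.

Lemma mcompBl F G u :
  mcomp T (fun x => F x - G x) S u = mcomp T F S u - mcomp T G S u.
Proof.
rewrite -mfoldBl; apply: eq_mfold => k x.
by rewrite msubstB // iterB.
Qed.

Lemma eq_mcomp F G u : F =1 G -> mcomp T F S u = mcomp T G S u.
Proof. by move=> FG; apply: eq_mfold => k x; rewrite FG. Qed.

Lemma cmap_mcomp (U' V' : zmodType) (phi : V -> V') (psi : U -> U')
    (T' S' : lmpoly V' -> lmpoly V') F
    (F' : U' -> lpoly V') u :
    zmod_morphism phi -> psi 0 = 0 ->
    zmod_morphism T' -> zmod_morphism S' -> zmod_morphism F' ->
    (forall w, cmap phi (T w) = T' (cmap phi w)) ->
    (forall w, cmap phi (S w) = S' (cmap phi w)) ->
    (forall x, cmap phi (F x) = F' (psi x)) ->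
  cmap phi (mcomp T F S u) = mcomp T' F' S' (cmap psi u).
Proof.
move=> phiB psi0 TB' SB' FB' phiT phiS phiF.
rewrite /mcomp mfold_morph; last exact: cmapB.
rewrite mfold_cmap //; last first.
  move=> k; rewrite (zmorph0 FB') (zmorph0 (msubstB TB')).
  by rewrite (zmorph0 (iterB k SB')).
apply: eq_mfold => k x; rewrite (iter_morph _ _ phiS).
by rewrite (cmap_msubst _ phiB TB' phiT) phiF.
Qed.

End Mcomp.

End PolynomialTheory.

Lemma linear_zmorph (C : fieldType) (A B : lmodType {poly C}) (f : A -> B) :
  linear f -> zmod_morphism f.
Proof.
move=> fL x y; rewrite addrC -[- y]scale1r scalerN -scaleNr fL.
by rewrite scaleNr scale1r addrC.
Qed.

(* A C[d]-module is an lmodType over {poly C}, with d acting as 'X and the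
   scalar k : C as k%:P. *)
Section LeibnizConformal.
Variable C : fieldType.

Definition finitely_generated (M : lmodType {poly C}) : Prop :=
  exists n (e : 'I_n -> M), forall x, exists c : 'I_n -> {poly C},
    x = \sum_(i < n) c i *: e i.

Record sesquilinear (A B M : lmodType {poly C})
    (f : A -> B -> lpoly M) : Prop := Sesquilinear {
  sesqPl : forall (k : C) a a' b,
    f (k%:P *: a + a') b = cmap ( *:%R k%:P) (f a b) + f a' b;
  sesqPr : forall (k : C) a b b',
    f a (k%:P *: b + b') = cmap ( *:%R k%:P) (f a b) + f a b';
  sesqXl : forall a b, f ('X *: a) b = - mul_lambda (f a b);
  sesqXr : forall a b,
    f a ('X *: b) = cmap ( *:%R 'X) (f a b) + mul_lambda (f a b)
}.

Record lca := Lca {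
  lca_mod :> lmodType {poly C};
  lbr : lca_mod -> lca_mod -> lpoly lca_mod;
  lbr_sesq : sesquilinear lbr;
  lbr_jacobi : forall a b c,
    mcomp lambda (lbr a) mu (lbr b c) =
      mcomp lambda_mu (lbr^~ c) lambda (lbr a b)
      + mcomp mu (lbr b) lambda (lbr a c)
}.

Definition bracket_morphism (A B : lca) (f : A -> B) : Prop :=
  forall a b, cmap f (lbr a b) = lbr (f a) (f b).

Record lca_hom (A B : lca) := LcaHom {
  hom_fun :> {linear A -> B};
  homP : bracket_morphism hom_fun
}.

Section Sesq.
Variables (A B M : lmodType {poly C}) (f : A -> B -> lpoly M).
Hypothesis fS : sesquilinear f.

Lemma scaleB (p : {poly C}) : zmod_morphism ( *:%R p : M -> M).
Proof. by move=> x y; rewrite scalerBr. Qed.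

Lemma cmap_opp (u : lpoly M) : cmap -%R u = - u.
Proof.
by apply/malgP => k; rewrite cmapE ?oppr0 // mcoeffN.
Qed.

Lemma cmap_scaleN1 (u : lpoly M) :
  cmap ( *:%R (- 1)%:P) u = - u.
Proof.
rewrite -cmap_opp; apply: eq_cmap => x.
by rewrite polyCN scaleNr scale1r.
Qed.

Lemma sesqBl b : zmod_morphism (f^~ b).
Proof.
move=> x y /=; rewrite addrC -[- y]scale1r scalerN -scaleNr -polyCN.
by rewrite (sesqPl fS) cmap_scaleN1 addrC.
Qed.

Lemma sesqBr a : zmod_morphism (f a).
Proof.
move=> x y /=; rewrite addrC -[- y]scale1r scalerN -scaleNr -polyCN.
by rewrite (sesqPr fS) cmap_scaleN1 addrC.
Qed.

End Sesq.

Lemma mfold0 (K : choiceType) (V W : zmodType) (F : K -> V -> W) :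
  mfold F 0 = 0.
Proof. by rewrite /mfold msupp0 big_seq_fset0. Qed.

Lemma zero_sesq (A B M : lmodType {poly C}) :
  sesquilinear (fun (_ : A) (_ : B) => 0 : lpoly M).
Proof.
split=> *; rewrite /cmap /mul_lambda /mshift ?mfold0 ?oppr0 ?addr0 //.
Qed.

Lemma zero_jacobi (H : lmodType {poly C}) (a b c : H) :
  let z := fun _ _ : H => 0 : lpoly H in
  mcomp lambda (z a) mu (z b c) =
    mcomp lambda_mu (z^~ c) lambda (z a b) + mcomp mu (z b) lambda (z a c).
Proof. by rewrite /= /mcomp !mfold0 addr0. Qed.

Definition zero_lca (H : lmodType {poly C}) : lca :=
  Lca (@zero_sesq H H H) (@zero_jacobi H).

Record abelian_extension (R : lca) (H : lmodType {poly C}) (E : lca) :=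
  AbelianExtension {
  inc : lca_hom (zero_lca H) E;
  proj : lca_hom E R;
  inc_inj : injective inc;
  proj_surj : range proj = setT;
  inc_proj : range inc = proj @^-1` [set 0]
}.

Record section (R : lca) (H : lmodType {poly C}) (E : lca)
    (ext : abelian_extension R H E) := Section {
  sec :> {linear R -> E};
  secK : cancel sec (proj ext)
}.

End LeibnizConformal.

(* The group of bijections of a set under composition; the automorphism groups
   are subgroups of it. *)
Section Sym.
Variable T : choiceType.

Record sym := Sym {
  sym_fun :> T -> T;
  sym_bij : `[< bijective sym_fun >]
}.

HB.instance Definition _ := [isSub for sym_fun].
HB.instance Definition _ := [Choice of sym by <:].

Lemma symP (f g : sym) : f =1 g <-> f = g.
Proof. by split=> [e|->//]; apply/val_inj/funext. Qed.

Lemma id_bij : `[< bijective (@idfun T) >].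
Proof. by apply/asboolP; exists id. Qed.

Lemma comp_bij (f g : sym) : `[< bijective (f \o g) >].
Proof.
by apply/asboolP/bij_comp; apply/asboolP; apply: sym_bij.
Qed.

Lemma inv_ex (f : sym) : exists g : T -> T, cancel f g /\ cancel g f.
Proof. by have /asboolP[g] := sym_bij f; exists g. Qed.

Lemma inv_bij (f : sym) : `[< bijective (sval (cid (inv_ex f))) >].
Proof. by apply/asboolP; case: cid => g [fK gK]; exists f. Qed.

Definition sym_one := Sym id_bij.
Definition sym_mul f g := Sym (comp_bij f g).
Definition sym_inv f := Sym (inv_bij f).

Lemma sym_invK (f : sym) : cancel f (sym_inv f).
Proof. by rewrite /=; case: cid => g []. Qed.

Lemma sym_Kinv (f : sym) : cancel (sym_inv f) f.
Proof. by rewrite /=; case: cid => g []. Qed.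

Lemma sym_mulA : associative sym_mul.
Proof. by move=> f g h; apply/symP. Qed.
Lemma sym_mul1 : left_id sym_one sym_mul.
Proof. by move=> f; apply/symP. Qed.
Lemma sym_1mul : right_id sym_one sym_mul.
Proof. by move=> f; apply/symP. Qed.
Lemma sym_mulV : left_inverse sym_one sym_inv sym_mul.
Proof. by move=> f; apply/symP => x; apply: sym_invK. Qed.
Lemma sym_Vmul : right_inverse sym_one sym_inv sym_mul.
Proof. by move=> f; apply/symP => x; apply: sym_Kinv. Qed.

HB.instance Definition _ :=
  isGroup.Build sym sym_mulA sym_mul1 sym_1mul sym_mulV sym_Vmul.

Lemma symM (f g : sym) x : (f * g)%g x = f (g x). Proof. by []. Qed.
Lemma sym1 x : (1%g : sym) x = x. Proof. by []. Qed.
Lemma symK (f : sym) : cancel f (f^-1)%g. Proof. exact: sym_invK. Qed.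
Lemma symVK (f : sym) : cancel (f^-1)%g f. Proof. exact: sym_Kinv. Qed.

End Sym.

Section AutomorphismGroups.
Variable C : fieldType.

Section ModuleAut.
Variable H : lmodType {poly C}.

Definition is_mod_aut : {pred sym H} := fun f => `[< linear f >].

Record mod_aut := ModAut {
  mod_aut_sym :> sym H;
  mod_autP : mod_aut_sym \in is_mod_aut
}.

Lemma is_mod_aut_group : group_closed is_mod_aut.
Proof.
split=> [|f g /asboolP fL /asboolP gL]; apply/asboolP => k x y //.
rewrite !symM -fL; congr (f _); apply: (can_inj (symK g)).
by rewrite gL !symVK.
Qed.

HB.instance Definition _ := [isSub for mod_aut_sym].
HB.instance Definition _ := [Choice of mod_aut by <:].
HB.instance Definition _ :=
  SubChoice_isSubGroup.Build _ _ mod_aut is_mod_aut_group.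

End ModuleAut.

Section LcaAut.
Variable R : lca C.

Definition is_lca_aut : {pred sym R} :=
  fun f => `[< linear f /\ bracket_morphism f >].

Record lca_aut := LcaAut {
  lca_aut_sym :> sym R;
  lca_autP : lca_aut_sym \in is_lca_aut
}.

Lemma is_lca_aut_group : group_closed is_lca_aut.
Proof.
split=> [|f g /asboolP[fL fB] /asboolP[gL gB]]; apply/asboolP.
  by split=> [k x y //|x y]; rewrite -[RHS]cmap_id.
have gVL : linear (g^-1)%g.
  by move=> k x y; apply: (can_inj (symK g)); rewrite gL !symVK.
split=> [k x y|x y]; first by rewrite !symM gVL fL.
rewrite !symM -fB -(@cmap_comp _ _ _ _ f (g^-1)%g).
- congr (cmap f _); apply: (@cmap_inj _ _ _ g).
  + exact: zmorph0 (linear_zmorph gL).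
  + exact: can_inj (symK g).
  rewrite cmap_comp ?(zmorph0 (linear_zmorph gL)) ?(zmorph0 (linear_zmorph gVL)) //.
  by rewrite gB !symVK -[RHS]cmap_id; apply: eq_cmap => z /=; rewrite symVK.
- exact: zmorph0 (linear_zmorph fL).
- exact: zmorph0 (linear_zmorph gVL).
Qed.

HB.instance Definition _ := [isSub for lca_aut_sym].
HB.instance Definition _ := [Choice of lca_aut by <:].
HB.instance Definition _ :=
  SubChoice_isSubGroup.Build _ _ lca_aut is_lca_aut_group.

End LcaAut.

End AutomorphismGroups.

Section SesqOperations.
Variable C : fieldType.
Implicit Types A B M N : lmodType {poly C}.

Lemma cmapD A B (phi : {linear A -> B}) (K : choiceType) (u v : {malg A[K]}) :
  cmap phi (u + v) = cmap phi u + cmap phi v.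
Proof. exact: zmorphD (cmapB (linear_zmorph (linearP phi))) u v. Qed.

Lemma cmapN A B (phi : {linear A -> B}) (K : choiceType) (u : {malg A[K]}) :
  cmap phi (- u) = - cmap phi u.
Proof. exact: zmorphN (cmapB (linear_zmorph (linearP phi))) u. Qed.

Lemma cmapZ A B (phi : {linear A -> B}) (q : {poly C}) (K : choiceType)
    (u : {malg A[K]}) :
  cmap phi (cmap ( *:%R q) u) = cmap ( *:%R q) (cmap phi u).
Proof.
rewrite !cmap_comp ?raddf0 ?scaler0 //.
by apply: eq_cmap => x /=; rewrite linearZ.
Qed.

Lemma cmapL A B (phi : {linear A -> B}) (u : lpoly A) :
  cmap phi (mul_lambda u) = mul_lambda (cmap phi u).
Proof. exact: cmap_mul_lambda (linear_zmorph (linearP phi)). Qed.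

Lemma sesq_sub A B M (f g : A -> B -> lpoly M) :
  sesquilinear f -> sesquilinear g ->
  sesquilinear (fun a b => f a b - g a b).
Proof.
move=> fS gS; split=> [k a a' b|k a b b'|a b|a b].
- by rewrite (sesqPl fS) (sesqPl gS) (cmapB (scaleB _)) opprD addrACA.
- by rewrite (sesqPr fS) (sesqPr gS) (cmapB (scaleB _)) opprD addrACA.
- by rewrite (sesqXl fS) (sesqXl gS) mul_lambdaB -!opprD.
- rewrite (sesqXr fS) (sesqXr gS) (cmapB (scaleB _)) mul_lambdaB.
  by rewrite opprD addrACA.
Qed.

Lemma sesq_map A B M N (phi : {linear M -> N}) (f : A -> B -> lpoly M) :
  sesquilinear f -> sesquilinear (fun a b => cmap phi (f a b)).
Proof.
move=> fS; split=> [k a a' b|k a b b'|a b|a b].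
- by rewrite (sesqPl fS) cmapD cmapZ.
- by rewrite (sesqPr fS) cmapD cmapZ.
- by rewrite (sesqXl fS) cmapN cmapL.
- by rewrite (sesqXr fS) cmapD cmapZ cmapL.
Qed.

Lemma sesq_unmap A B M N (phi : {linear M -> N}) (f : A -> B -> lpoly M) :
  injective phi -> sesquilinear (fun a b => cmap phi (f a b)) ->
  sesquilinear f.
Proof.
move=> phiI fS.
have cI : injective (@cmap nat _ _ phi) by apply: cmap_inj phiI; exact: raddf0.
split=> [k a a' b|k a b b'|a b|a b]; apply: cI.
- by rewrite (sesqPl fS) cmapD cmapZ.
- by rewrite (sesqPr fS) cmapD cmapZ.
- by rewrite (sesqXl fS) cmapN cmapL.
- by rewrite (sesqXr fS) cmapD cmapZ cmapL.
Qed.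

Lemma sesq_precomp A B A' B' M (f : A -> B -> lpoly M)
    (phi : {linear A' -> A}) (psi : {linear B' -> B}) :
  sesquilinear f -> sesquilinear (fun a b => f (phi a) (psi b)).
Proof.
move=> fS; split=> [k a a' b|k a b b'|a b|a b].
- by rewrite linearP (sesqPl fS).
- by rewrite linearP (sesqPr fS).
- by rewrite linearZ (sesqXl fS).
- by rewrite linearZ (sesqXr fS).
Qed.

Lemma cmap_mcompL (U U' V V' : lmodType {poly C}) (phi : {linear V -> V'})
    (psi : {linear U -> U'})
    (T S : forall V : zmodType, lmpoly V -> lmpoly V)
    (F : U -> lpoly V) (F' : U' -> lpoly V') u :
    (forall V, zmod_morphism (T V)) -> (forall V, zmod_morphism (S V)) ->
    (forall (f : {linear V -> V'}) w, cmap f (T _ w) = T _ (cmap f w)) ->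
    (forall (f : {linear V -> V'}) w, cmap f (S _ w) = S _ (cmap f w)) ->
    zmod_morphism F' -> (forall x, cmap phi (F x) = F' (psi x)) ->
  cmap phi (mcomp (T _) F (S _) u) = mcomp (T _) F' (S _) (cmap psi u).
Proof.
move=> TB SB Tn Sn F'B FF'.
apply: cmap_mcomp => //; first exact: linear_zmorph (linearP phi).
exact: raddf0.
Qed.

Lemma mcomp_sub (U U' V W X : lmodType {poly C}) (phi : {linear V -> X})
    (phi2 : {linear W -> X}) (psi : {linear U -> U'})
    (T S : forall V : zmodType, lmpoly V -> lmpoly V)
    (F : U -> lpoly V) (F1 : U' -> lpoly X) (F2 : U -> lpoly W) u :
    (forall V, zmod_morphism (T V)) -> (forall V, zmod_morphism (S V)) ->
    (forall (A B : lmodType {poly C}) (f : {linear A -> B}) w,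
      cmap f (T _ w) = T _ (cmap f w)) ->
    (forall (A B : lmodType {poly C}) (f : {linear A -> B}) w,
      cmap f (S _ w) = S _ (cmap f w)) ->
    zmod_morphism F1 ->
    (forall x, cmap phi (F x) = F1 (psi x) - cmap phi2 (F2 x)) ->
  cmap phi (mcomp (T _) F (S _) u) =
  mcomp (T _) F1 (S _) (cmap psi u) - cmap phi2 (mcomp (T _) F2 (S _) u).
Proof.
move=> TB SB Tn Sn F1B FF.
have key (A B : lmodType {poly C}) (f : {linear A -> B}) (G : U -> lpoly A) :
    cmap f (mcomp (T _) G (S _) u) =
    mfold (fun k x => iter k (S B) (msubst (T B) (cmap f (G x)))) u.
  have fB := linear_zmorph (linearP f).
  rewrite /mcomp mfold_morph; last exact: cmapB.
  apply: eq_mfold => k x; rewrite (iter_morph _ _ (Sn _ _ f)).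
  by rewrite (cmap_msubst _ fB (TB _) (Tn _ _ f)).
rewrite !key [mcomp _ F1 _ _]mfold_cmap ?raddf0 //; last first.
  move=> k; rewrite (zmorph0 F1B) (zmorph0 (msubstB (TB _))).
  exact: zmorph0 (iterB k (SB _)).
rewrite -mfoldBl; apply: eq_mfold => k x.
by rewrite FF msubstB // iterB.
Qed.

Let lamN (V W : lmodType {poly C}) (f : {linear V -> W}) (w : lmpoly V) :
  cmap f (lambda w) = lambda (cmap f w).
Proof. exact: cmap_lambda (linear_zmorph (linearP f)). Qed.

Let muN (V W : lmodType {poly C}) (f : {linear V -> W}) (w : lmpoly V) :
  cmap f (mu w) = mu (cmap f w).
Proof. exact: cmap_mu (linear_zmorph (linearP f)). Qed.

Let lmN (V W : lmodType {poly C}) (f : {linear V -> W}) (w : lmpoly V) :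
  cmap f (lambda_mu w) = lambda_mu (cmap f w).
Proof. exact: cmap_lambda_mu (linear_zmorph (linearP f)). Qed.

Section Natural.
Variables (U U' V V' : lmodType {poly C}) (phi : {linear V -> V'}).
Variables (psi : {linear U -> U'}) (F : U -> lpoly V) (F' : U' -> lpoly V').
Hypotheses (F'B : zmod_morphism F') (FF' : forall x, cmap phi (F x) = F' (psi x)).

Lemma natural_lm u :
  cmap phi (mcomp lambda F mu u) = mcomp lambda F' mu (cmap psi u).
Proof.
exact: (@cmap_mcompL _ _ _ _ phi psi (@lambda) (@mu) F F' u (@lambdaB) (@muB)
  (@lamN _ _) (@muN _ _)).
Qed.

Lemma natural_ml u :
  cmap phi (mcomp mu F lambda u) = mcomp mu F' lambda (cmap psi u).
Proof.
exact: (@cmap_mcompL _ _ _ _ phi psi (@mu) (@lambda) F F' u (@muB) (@lambdaB)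
  (@muN _ _) (@lamN _ _)).
Qed.

Lemma natural_sl u :
  cmap phi (mcomp lambda_mu F lambda u) =
  mcomp lambda_mu F' lambda (cmap psi u).
Proof.
exact: (@cmap_mcompL _ _ _ _ phi psi (@lambda_mu) (@lambda) F F' u
  (@lambda_muB) (@lambdaB) (@lmN _ _) (@lamN _ _)).
Qed.

End Natural.

Lemma cancel_terms (V : zmodType) (x y p q r u v : V) :
  x + y - p - (y - q) - (x - r) - (r - u) - (q - v) + (p - (u + v)) = 0.
Proof.
have t (a b c : V) : a + b - (b - c) = a + c by rewrite opprB addrA addrAC addrK.
have -> : x + y - p - (y - q) = x + (q - p).
  by rewrite [x + y - p]addrAC t addrAC addrA.
rewrite [x + (q - p)]addrC t t.
have -> : q - p + u = u - p + q by rewrite addrAC [q + u]addrC addrAC.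
by rewrite t [u - p + v]addrAC addrA subrK subrr.
Qed.

Section CocycleOfSection.
Variables (R H E : lmodType {poly C}).
Variables (i : {linear H -> E}) (s : {linear R -> E}).
Variables (brR : R -> R -> lpoly R) (brE : E -> E -> lpoly E).
Variables (al : R -> H -> lpoly H) (ar : H -> R -> lpoly H).
Variable (ch : R -> R -> lpoly H).
Hypotheses (iI : injective i).
Hypotheses (RS : sesquilinear brR) (ES : sesquilinear brE).
Hypotheses (alE : forall a h, cmap i (al a h) = brE (s a) (i h)).
Hypotheses (arE : forall h a, cmap i (ar h a) = brE (i h) (s a)).
Hypothesis
  chE : forall a b, cmap i (ch a b) = brE (s a) (s b) - cmap s (brR a b).
Variables a b c : R.
Hypothesis jacR : mcomp lambda (brR a) mu (brR b c) =
  mcomp lambda_mu (brR^~ c) lambda (brR a b) + mcomp mu (brR b) lambda (brR a c).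
Hypothesis jacE : mcomp lambda (brE (s a)) mu (brE (s b) (s c)) =
  mcomp lambda_mu (brE^~ (s c)) lambda (brE (s a) (s b))
  + mcomp mu (brE (s b)) lambda (brE (s a) (s c)).

Lemma section_chi_sesq : sesquilinear ch.
Proof.
apply: (sesq_unmap iI).
rewrite (_ : (fun _ => _) =
  fun a b => brE (s a) (s b) - cmap s (brR a b)); last first.
  by apply/funext => x; apply/funext => y; rewrite chE.
by apply: sesq_sub; [apply: sesq_precomp | apply: sesq_map].
Qed.

Lemma section_cocycle :
  mcomp lambda (al a) mu (ch b c) - mcomp mu (al b) lambda (ch a c)
  - mcomp lambda_mu (ar^~ c) lambda (ch a b)
  - mcomp lambda_mu (ch^~ c) lambda (brR a b)
  - mcomp mu (ch b) lambda (brR a c) + mcomp lambda (ch a) mu (brR b c) = 0.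
Proof.
have chS := section_chi_sesq.
apply: (@cmap_inj _ _ _ i) => //; first exact: raddf0.
have iB (K : choiceType) (u v : {malg H[K]}) :
  cmap i (u - v) = cmap i u - cmap i v by rewrite cmapD cmapN.
have EBl x : zmod_morphism (brE^~ x) := sesqBl ES x.
have EBr x : zmod_morphism (brE x) := sesqBr ES x.
have i0 : cmap i (0 : lmpoly H) = 0 by rewrite /cmap mfold0.
rewrite i0 cmapD !iB.
rewrite (natural_lm (EBr (s a)) (alE a)) (natural_ml (EBr (s b)) (alE b)).
rewrite (natural_sl (EBl (s c)) (arE^~ c)) !chE.
rewrite (mcompB lambdaB muB (EBr _)) (mcompB muB lambdaB (EBr _)).
rewrite (mcompB lambda_muB lambdaB (EBl _)).
have e1 : cmap i (mcomp lambda_mu (ch^~ c) lambda (brR a b)) =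
    mcomp lambda_mu (brE^~ (s c)) lambda (cmap s (brR a b))
    - cmap s (mcomp lambda_mu (brR^~ c) lambda (brR a b)).
  exact: (mcomp_sub (psi := s) (T := @lambda_mu) (S := @lambda) _ (@lambda_muB) (@lambdaB) (@lmN)
    (@lamN) (EBl (s c)) (fun x => chE x c)).
have e2 : cmap i (mcomp mu (ch b) lambda (brR a c)) =
    mcomp mu (brE (s b)) lambda (cmap s (brR a c))
    - cmap s (mcomp mu (brR b) lambda (brR a c)).
  exact: (mcomp_sub (psi := s) (T := @mu) (S := @lambda) _ (@muB) (@lambdaB) (@muN)
    (@lamN) (EBr (s b)) (chE b)).
have e3 : cmap i (mcomp lambda (ch a) mu (brR b c)) =
    mcomp lambda (brE (s a)) mu (cmap s (brR b c))
    - cmap s (mcomp lambda (brR a) mu (brR b c)).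
  exact: (mcomp_sub (psi := s) (T := @lambda) (S := @mu) _ (@lambdaB) (@muB) (@lamN)
    (@muN) (EBr (s a)) (chE a)).
rewrite e1 e2 e3 jacE jacR cmapD.
exact: cancel_terms.
Qed.
End CocycleOfSection.

Section Twist.
Variables (R H : lmodType {poly C}).
Variables (g : {linear H -> H}) (f : {linear R -> R}).
Variables (brR : R -> R -> lpoly R).
Variables (al : R -> H -> lpoly H) (ar : H -> R -> lpoly H).
Variables (ch tw : R -> R -> lpoly H).
Hypotheses (alB : forall a, zmod_morphism (al a)).
Hypotheses (arB : forall a, zmod_morphism (ar^~ a)).
Hypothesis (twS : sesquilinear tw).
Hypotheses (brf : forall a b, cmap f (brR a b) = brR (f a) (f b)).
Hypotheses (alE : forall a h, cmap g (al a h) = al (f a) (g h)).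
Hypotheses (arE : forall a h, cmap g (ar h a) = ar (g h) (f a)).
Hypotheses (twE : forall a b, cmap g (ch a b) = tw (f a) (f b)).

Lemma twist_natural (a b c : R) :
  cmap g (mcomp lambda (al a) mu (ch b c) - mcomp mu (al b) lambda (ch a c)
    - mcomp lambda_mu (ar^~ c) lambda (ch a b)
    - mcomp lambda_mu (ch^~ c) lambda (brR a b)
    - mcomp mu (ch b) lambda (brR a c) + mcomp lambda (ch a) mu (brR b c)) =
  mcomp lambda (al (f a)) mu (tw (f b) (f c))
    - mcomp mu (al (f b)) lambda (tw (f a) (f c))
    - mcomp lambda_mu (ar^~ (f c)) lambda (tw (f a) (f b))
    - mcomp lambda_mu (tw^~ (f c)) lambda (brR (f a) (f b))
    - mcomp mu (tw (f b)) lambda (brR (f a) (f c))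
    + mcomp lambda (tw (f a)) mu (brR (f b) (f c)).
Proof.
have twBl x : zmod_morphism (tw^~ x) := sesqBl twS x.
have twBr x : zmod_morphism (tw x) := sesqBr twS x.
have gB (K : choiceType) (u v : {malg H[K]}) :
  cmap g (u - v) = cmap g u - cmap g v by rewrite cmapD cmapN.
rewrite cmapD !gB.
rewrite (natural_lm (alB (f a)) (alE a)) (natural_ml (alB (f b)) (alE b)).
rewrite (natural_sl (arB (f c)) (arE c)) !twE.
rewrite (natural_sl (twBl (f c)) (twE^~ c)) (natural_ml (twBr (f b)) (twE b)).
by rewrite (natural_lm (twBr (f a)) (twE a)) !brf.
Qed.

End Twist.

End SesqOperations.

Definition linear_of (C : fieldType) (A B : lmodType {poly C}) (f : A -> B)
    (fL : linear f) : {linear A -> B} :=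
  HB.pack f (GRing.isLinear.Build _ _ _ _ f fL).

Section Extension.
Variable C : fieldType.
Variables (R : lca C) (H : lmodType {poly C}) (E : lca C).
Variables (ext : abelian_extension R H E) (s : section ext).

Local Notation alpha := (inc ext).
Local Notation p := (proj ext).

(* The inverse of alpha on alpha(H), undoing the identification of H with
   alpha(H); it is only used on elements of ker p = alpha(H). *)
Definition inc_inv (e : E) : H := xget 0 [set h | alpha h = e].

Definition act_l (a : R) (h : H) : lpoly H := cmap inc_inv (lbr (s a) (alpha h)).

Definition act_r (h : H) (a : R) : lpoly H := cmap inc_inv (lbr (alpha h) (s a)).

Definition chi (a b : R) : lpoly H :=
  cmap inc_inv (lbr (s a) (s b) - cmap s (lbr a b)).

Definition delta1 (beta : R -> H) (a b : R) : lpoly H :=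
  act_l a (beta b) + act_r (beta a) b - cmap beta (lbr a b).

Definition delta2 (f : R -> R -> lpoly H) (a b c : R) : lmpoly H :=
  mcomp lambda (act_l a) mu (f b c)
  - mcomp mu (act_l b) lambda (f a c)
  - mcomp lambda_mu (act_r^~ c) lambda (f a b)
  - mcomp lambda_mu (f^~ c) lambda (lbr a b)
  - mcomp mu (f b) lambda (lbr a c)
  + mcomp lambda (f a) mu (lbr b c).

Definition is_cocycle : {pred R -> R -> lpoly H} := fun f =>
  `[< sesquilinear f /\ forall a b c, delta2 f a b c = 0 >].

Record Z2 := Cocycle {
  cocycle_fun :> R -> R -> lpoly H;
  cocycleP : cocycle_fun \in is_cocycle
}.

(* C^1(R, H) is the type {linear R -> H}; coboundaries are cocycles by
   delta1_cocycle below. *)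
Definition is_coboundary : {pred Z2} := fun f =>
  `[< exists beta : {linear R -> H}, cocycle_fun f = delta1 beta >].

Definition compatible (g : sym H) (f : sym R) : Prop :=
  (forall a h, cmap g (act_l a h) = act_l (f a) (g h)) /\
  (forall a h, cmap g (act_r h a) = act_r (g h) (f a)).

Definition is_compatible : {pred mod_aut H * lca_aut R} := fun gf =>
  `[< compatible gf.1 gf.2 >].

Record aut_pair := AutPair {
  aut_pair_val :> mod_aut H * lca_aut R;
  aut_pairP : aut_pair_val \in is_compatible
}.

Definition preserves_H : {pred lca_aut E} := fun f =>
  `[< f @` range alpha = range alpha >].

Record autH := AutH {
  autH_lca :> lca_aut E;
  autHP : autH_lca \in preserves_H
}.

Definition restr (f : E -> E) (h : H) : H := inc_inv (f (alpha h)).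

Definition hat (f : E -> E) (a : R) : R := p (f (s a)).

Definition induces_id : {pred autH} := fun f =>
  `[< restr f = id /\ hat f = id >].

Record aut_idH := AutIdH {
  iota_idH :> autH;
  aut_idHP : iota_idH \in induces_id
}.

Let incB := linear_zmorph (linearP alpha).
Let projB := linear_zmorph (linearP p).
Let secB := linear_zmorph (linearP s).
Let lbrBl (A : lca C) (b : A) := sesqBl (@lbr_sesq _ A) b.
Let lbrBr (A : lca C) (a : A) := sesqBr (@lbr_sesq _ A) a.

Lemma incK : cancel alpha inc_inv.
Proof. by move=> h; apply: (@inc_inj _ _ _ _ ext); rewrite /inc_inv; case: xgetP => [x _ ->|/(_ h)/(_ erefl)]. Qed.

Lemma proj_inc h : p (alpha h) = 0.
Proof.
have : range alpha (alpha h) by exists h.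
by rewrite inc_proj.
Qed.

Lemma inc_invK e : p e = 0 -> alpha (inc_inv e) = e.
Proof.
move=> pe; have : range alpha e by rewrite inc_proj.
by case=> h _ <-; rewrite incK.
Qed.

Lemma inc_inv0 : inc_inv 0 = 0.
Proof. by rewrite -(raddf0 alpha) incK. Qed.

Lemma cmap_incK (u : lpoly E) : cmap p u = 0 -> cmap alpha (cmap inc_inv u) = u.
Proof.
move=> pu; apply/malgP => k.
rewrite !cmapE ?inc_inv0 ?raddf0 // inc_invK //.
by rewrite -cmapE ?raddf0 // pu mcoeff0.
Qed.

Lemma cmap_inc_inj (K : choiceType) :
  injective (cmap alpha : {malg H[K]} -> {malg E[K]}).
Proof. by apply: cmap_inj; [exact: raddf0 | exact: inc_inj]. Qed.

Lemma act_lE a h : cmap alpha (act_l a h) = lbr (s a) (alpha h).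
Proof.
apply: cmap_incK; rewrite (homP p) proj_inc.
exact: (zmorph0 (@lbrBr _ _)).
Qed.

Lemma act_rE h a : cmap alpha (act_r h a) = lbr (alpha h) (s a).
Proof.
apply: cmap_incK; rewrite (homP p) proj_inc.
exact: (zmorph0 (@lbrBl _ _)).
Qed.

Lemma chiE a b :
  cmap alpha (chi a b) = lbr (s a) (s b) - cmap s (lbr a b).
Proof.
apply: cmap_incK; rewrite (cmapB projB) (homP p) !secK cmap_comp ?raddf0 //.
rewrite (eq_cmap (psi := id)) ?cmap_id ?subrr // => x.
exact: secK.
Qed.

Lemma lbr_inc h h' : lbr (alpha h) (alpha h') = 0.
Proof. by rewrite -(homP alpha) /cmap mfold0. Qed.

Lemma act_lB a : zmod_morphism (act_l a).
Proof.
move=> x y; apply: cmap_inc_inj.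
by rewrite (cmapB incB) !act_lE incB lbrBr.
Qed.

Lemma act_rB a : zmod_morphism (act_r^~ a).
Proof.
move=> x y; apply: cmap_inc_inj.
by rewrite (cmapB incB) !act_rE incB (lbrBl _ (alpha x)).
Qed.

Lemma sub_add3 (V : zmodType) (x1 x2 x3 y1 y2 y3 : V) :
  (x1 - y1) + (x2 - y2) - (x3 - y3) = (x1 + x2 - x3) - (y1 + y2 - y3).
Proof.
have -> : (x1 - y1) + (x2 - y2) = (x1 + x2) - (y1 + y2).
  by rewrite addrACA opprD.
by rewrite !opprD !opprK addrACA.
Qed.

Lemma sub_add6 (V : zmodType) (x1 x2 x3 x4 x5 x6 y1 y2 y3 y4 y5 y6 : V) :
  (x1 - y1) - (x2 - y2) - (x3 - y3) - (x4 - y4) - (x5 - y5) + (x6 - y6)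
  = (x1 - x2 - x3 - x4 - x5 + x6) - (y1 - y2 - y3 - y4 - y5 + y6).
Proof.
have sB (a b c d : V) : (a - b) - (c - d) = (a - c) - (b - d).
  by rewrite !opprD !opprK addrACA.
have sD (a b c d : V) : (a - b) + (c - d) = (a + c) - (b + d).
  by rewrite addrACA opprD.
by rewrite (sB x1) (sB (x1 - x2)) (sB (x1 - x2 - x3)) (sB (x1 - x2 - x3 - x4)) sD.
Qed.

Lemma delta2B f g a b c :
  delta2 (f - g) a b c = delta2 f a b c - delta2 g a b c.
Proof.
rewrite /delta2 !fctE.
rewrite (mcompB lambdaB muB (act_lB a)) (mcompB muB lambdaB (act_lB b)).
rewrite (mcompB lambda_muB lambdaB (act_rB c)).
rewrite (mcompBl lambda_muB lambdaB (f^~ c) (g^~ c)).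
rewrite (mcompBl muB lambdaB (f b) (g b)) (mcompBl lambdaB muB (f a) (g a)).
exact: sub_add6.
Qed.


Lemma is_cocycle_zmod : zmod_closed is_cocycle.
Proof.
split=> [|f g /asboolP[fS f0] /asboolP[gS g0]]; apply/asboolP; split.
- exact: zero_sesq.
- by move=> a b c; rewrite -(subrr 0) delta2B subrr.
- exact: sesq_sub fS gS.
- by move=> a b c; rewrite delta2B f0 g0 subr0.
Qed.

HB.instance Definition _ :=
  GRing.isZmodClosed.Build (R -> R -> lpoly H) is_cocycle is_cocycle_zmod.
HB.instance Definition _ := [isSub for cocycle_fun].
HB.instance Definition _ := [Choice of Z2 by <:].
HB.instance Definition _ := [SubChoice_isSubZmodule of Z2 by <:].

Lemma delta1B (f g : {linear R -> H}) :
  delta1 (f \- g) = delta1 f - delta1 g.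
Proof.
apply/funext => a; apply/funext => b; rewrite !fctE /delta1 act_lB.
rewrite (act_rB b (f a)).
have -> : cmap (f \- g) (lbr a b) = cmap f (lbr a b) - cmap g (lbr a b).
  by apply/malgP => k; rewrite mcoeffB !cmapE ?raddf0 //= ?raddf0 subrr.
exact: sub_add3.
Qed.

Lemma is_coboundary_zmod : zmod_closed is_coboundary.
Proof.
split=> [|f g /asboolP[bf ef] /asboolP[bg eg]]; apply/asboolP.
  by exists (\0 \- \0); rewrite delta1B subrr.
by exists (bf \- bg); rewrite delta1B -ef -eg.
Qed.

HB.instance Definition _ :=
  GRing.isZmodClosed.Build Z2 is_coboundary is_coboundary_zmod.

Definition H2 : zmodType := Quotient.quot is_coboundary.

Lemma mod_aut_linear (M : lmodType {poly C}) (g : mod_aut M) : linear g.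
Proof. exact/asboolP/(mod_autP g). Qed.

Lemma lca_aut_linear (A : lca C) (f : lca_aut A) : linear f.
Proof. by have /asboolP[] := lca_autP f. Qed.

Lemma lca_aut_bracket (A : lca C) (f : lca_aut A) : bracket_morphism f.
Proof. by have /asboolP[] := lca_autP f. Qed.

Let mautB (M : lmodType {poly C}) (g : mod_aut M) :=
  linear_zmorph (mod_aut_linear g).
Let lautB (A : lca C) (f : lca_aut A) := linear_zmorph (lca_aut_linear f).

Lemma is_compatible_group : group_closed is_compatible.
Proof.
split=> [|f g /asboolP[fl fr] /asboolP[gl gr]]; apply/asboolP.
  by split=> a h; rewrite cmap_id.
have gV1 : (g^-1)%g.1 = (g.1^-1)%g by [].
have gV2 : (g^-1)%g.2 = (g.2^-1)%g by [].
have comp (u : lpoly H) : cmap (f / g)%g.1 (cmap g.1 u) = cmap f.1 u.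
  rewrite cmap_comp ?(zmorph0 (mautB _)) //.
  by apply: eq_cmap => x /=; congr (f.1 _); apply: symK.
have fg1 h : (f / g)%g.1 h = f.1 ((g.1^-1)%g h) by [].
have fg2 a : (f / g)%g.2 a = f.2 ((g.2^-1)%g a) by [].
have g1K h : g.1 ((g.1^-1)%g h) = h by apply: symVK.
have g2K a : g.2 ((g.2^-1)%g a) = a by apply: symVK.
split=> a h.
  by rewrite -{1}[a]g2K -{1}[h]g1K -gl comp fl fg1 fg2.
by rewrite -{1}[a]g2K -{1}[h]g1K -gr comp fr fg1 fg2.
Qed.

HB.instance Definition _ := [isSub for aut_pair_val].
HB.instance Definition _ := [Choice of aut_pair by <:].
HB.instance Definition _ :=
  SubChoice_isSubGroup.Build _ _ aut_pair is_compatible_group.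

Lemma preserves_H_group : group_closed preserves_H.
Proof.
split=> [|f g /asboolP fH /asboolP gH]; apply/asboolP.
  by rewrite (_ : _ @` _ = id @` range alpha) ?image_id.
have gVH : (g^-1)%g @` range alpha = range alpha.
  rewrite -{1}gH (image_comp g (g^-1)%g (range alpha)).
  rewrite (_ : (g^-1)%g \o g = id) ?image_id //.
  by apply/funext => x /=; apply: symK.
rewrite -[RHS]fH -{2}gVH.
exact: esym (image_comp (g^-1)%g f (range alpha)).
Qed.

HB.instance Definition _ := [isSub for autH_lca].
HB.instance Definition _ := [Choice of autH by <:].
HB.instance Definition _ :=
  SubChoice_isSubGroup.Build _ _ autH preserves_H_group.

Lemma autH_inc (f : autH) h : alpha (restr f h) = f (alpha h).
Proof.
have : range alpha (f (alpha h)).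
  by have /asboolP <- := autHP f; exists (alpha h) => //; exists h.
by case=> h' _ e; rewrite /restr -e incK.
Qed.

Lemma autH_hat (f : autH) e : hat f (p e) = p (f e).
Proof.
have [h _ eh] : range alpha (s (p e) - e).
  by rewrite inc_proj /preimage /= projB secK subrr.
apply/eqP; rewrite -subr_eq0 -projB -(lautB f) -eh -autH_inc.
by rewrite proj_inc.
Qed.

Lemma restrM (f g : autH) h : restr (f * g)%g h = restr f (restr g h).
Proof.
by apply: (@inc_inj _ _ _ _ ext); rewrite !autH_inc.
Qed.

Lemma hatM (f g : autH) a : hat (f * g)%g a = hat f (hat g a).
Proof. by rewrite {3}/hat autH_hat. Qed.

Lemma restr1 h : restr (1%g : autH) h = h.
Proof. exact: incK. Qed.

Lemma hat1 a : hat (1%g : autH) a = a.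
Proof. exact: secK. Qed.

Lemma induces_id_group : group_closed induces_id.
Proof.
split=> [|f g /asboolP[fr fh] /asboolP[gr gh]]; apply/asboolP.
  by split; apply/funext => x; rewrite ?restr1 ?hat1.
split; apply/funext => x.
  by rewrite restrM fr /= -[RHS](restr1 x) -(mulgV g) restrM gr.
by rewrite hatM fh /= -[RHS](hat1 x) -(mulgV g) hatM gh.
Qed.

HB.instance Definition _ := [isSub for iota_idH].
HB.instance Definition _ := [Choice of aut_idH by <:].
HB.instance Definition _ :=
  SubChoice_isSubGroup.Build _ _ aut_idH induces_id_group.

Lemma iota_morphism : monoid.monoid_morphism iota_idH.
Proof. by split. Qed.

HB.instance Definition _ :=
  isUMagmaMorphism.Build aut_idH autH iota_idH iota_morphism.

Section Kappa.
Variable f : autH.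

Lemma restr_bij : `[< bijective (restr f) >].
Proof.
apply/asboolP; exists (restr (f^-1)%g) => h.
  by rewrite -restrM mulVg restr1.
by rewrite -restrM mulgV restr1.
Qed.

Lemma hat_bij : `[< bijective (hat f) >].
Proof.
apply/asboolP; exists (hat (f^-1)%g) => a.
  by rewrite -hatM mulVg hat1.
by rewrite -hatM mulgV hat1.
Qed.

Lemma restr_aut : Sym restr_bij \in @is_mod_aut _ H.
Proof.
apply/asboolP => k x y /=; apply: (@inc_inj _ _ _ _ ext).
by rewrite linearP !autH_inc linearP lca_aut_linear.
Qed.

Lemma hat_linear : linear (hat f).
Proof. by move=> k x y; rewrite /hat linearP lca_aut_linear linearP. Qed.

Lemma hat_aut : Sym hat_bij \in @is_lca_aut _ R.
Proof.
apply/asboolP; split; first exact: hat_linear.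
move=> a b /=.
have -> : lbr a b = cmap p (lbr (s a) (s b)) by rewrite (homP p) !secK.
have -> : lbr (hat f a) (hat f b) = cmap p (cmap f (lbr (s a) (s b))).
  by rewrite lca_aut_bracket (homP p).
have h0 := zmorph0 (linear_zmorph hat_linear).
rewrite !cmap_comp ?raddf0 ?(zmorph0 (lautB f)) //.
by apply: eq_cmap => x /=; rewrite autH_hat.
Qed.

Definition kappa_fun : mod_aut H * lca_aut R :=
  (ModAut restr_aut, LcaAut hat_aut).

Lemma sec_hat a : exists h, s (hat f a) = f (s a) + alpha h.
Proof.
have [h _ eh] : range alpha (s (hat f a) - f (s a)).
  by rewrite inc_proj /preimage /= projB secK subrr.
by exists h; rewrite eh addrC subrK.
Qed.

Lemma kappa_compatible : kappa_fun \in is_compatible.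
Proof.
have r0 : restr f 0 = 0 by apply: zmorph0 (mautB (ModAut restr_aut)).
have f0 := zmorph0 (lautB f).
have ir (u : lpoly H) :
    cmap alpha (cmap (restr f) u) = cmap f (cmap alpha u).
  by rewrite !cmap_comp ?raddf0 //; apply: eq_cmap => h; apply: autH_inc.
apply/asboolP; split=> a h /=; apply: cmap_inc_inj; rewrite ir.
  rewrite !act_lE lca_aut_bracket autH_inc.
  have [h' ->] := sec_hat a.
  by rewrite (zmorphD (@lbrBl _ _)) -(autH_inc f h) lbr_inc addr0.
rewrite !act_rE lca_aut_bracket autH_inc.
have [h' ->] := sec_hat a.
by rewrite (zmorphD (@lbrBr _ _)) -(autH_inc f h) lbr_inc addr0.
Qed.

Definition kappa : aut_pair := AutPair kappa_compatible.

End Kappa.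

Lemma kappa_morphism : monoid.monoid_morphism kappa.
Proof.
split=> [|f g]; apply/val_inj; congr (_, _); apply/val_inj/symP => x /=.
- exact: restr1.
- exact: hat1.
- exact: restrM.
- exact: hatM.
Qed.

HB.instance Definition _ :=
  isUMagmaMorphism.Build autH aut_pair kappa kappa_morphism.

Let alphaL : {linear H -> E} := alpha.

Lemma chi_sesq : sesquilinear chi.
Proof.
exact: (@section_chi_sesq _ R H E alphaL s (@lbr _ R) (@lbr _ E) chi
  (@inc_inj _ _ _ _ ext) (@lbr_sesq _ R) (@lbr_sesq _ E) chiE).
Qed.

Lemma delta2_chi a b c : delta2 chi a b c = 0.
Proof.
exact: (@section_cocycle _ R H E alphaL s (@lbr _ R) (@lbr _ E) act_l act_r chi
  (@inc_inj _ _ _ _ ext) (@lbr_sesq _ R) (@lbr_sesq _ E) act_lE act_rE chiE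
  a b c (lbr_jacobi a b c) (lbr_jacobi (s a) (s b) (s c))).
Qed.

Lemma chi_cocycle : chi \in is_cocycle.
Proof. by apply/asboolP; split; [exact: chi_sesq | exact: delta2_chi]. Qed.

Definition chi_twist (g : sym H) (f : sym R) (a b : R) : lpoly H :=
  cmap g (chi ((f^-1)%g a) ((f^-1)%g b)).

Lemma chi_twist_cocycle (gf : aut_pair) :
  chi_twist gf.1 gf.2 \in is_cocycle.
Proof.
have /asboolP[cl cr] := aut_pairP gf.
pose gL := linear_of (mod_aut_linear gf.1).
pose fL := linear_of (lca_aut_linear gf.2).
pose fVL := linear_of (lca_aut_linear (gf.2^-1)%g).
have twS : sesquilinear (chi_twist gf.1 gf.2).
  exact: (sesq_map gL (sesq_precomp fVL fVL chi_sesq)).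
apply/asboolP; split=> // a b c.
have twE x y : cmap gL (chi x y) = chi_twist gf.1 gf.2 (fL x) (fL y).
  have fK z : ((gf.2 : sym R)^-1)%g (fL z) = z by exact: symK.
  by rewrite /chi_twist !fK.
pose fV : R -> R := ((gf.2 : sym R)^-1)%g.
have fVK z : fL (fV z) = z by exact: symVK.
have e : cmap gL (delta2 chi (fV a) (fV b) (fV c)) =
    delta2 (chi_twist gf.1 gf.2) (fL (fV a)) (fL (fV b)) (fL (fV c)).
  exact: (@twist_natural _ R H gL fL (@lbr _ R) act_l act_r chi
    (chi_twist gf.1 gf.2) act_lB act_rB twS (@lca_aut_bracket _ gf.2) cl
    (fun a h => cr a h) twE).
move: e; rewrite !fVK delta2_chi => <-.
by rewrite /cmap mfold0.
Qed.

Lemma wells_cocycle (gf : aut_pair) :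
  chi_twist gf.1 gf.2 - chi \in is_cocycle.
Proof. exact: rpredB (chi_twist_cocycle gf) chi_cocycle. Qed.

Definition wells (gf : aut_pair) : H2 := \pi_H2 (Cocycle (wells_cocycle gf)).

End Extension.

Arguments iota_idH {C R H E ext} s f : rename.
Arguments kappa {C R H E ext} s f.
Arguments wells {C R H E ext} s gf.

Section ChangeOfSection.
Variable C : fieldType.
Variables (R : lca C) (H : lmodType {poly C}) (E : lca C).
Variables (ext : abelian_extension R H E) (s : section ext).
Variable beta : {linear R -> H}.

Let alphaL : {linear H -> E} := inc ext.

Definition shift_fun (a : R) : E := s a + alphaL (beta a).

Lemma shift_linear : linear shift_fun.
Proof.
move=> k x y; rewrite /shift_fun !linearP scalerDr addrACA.
by congr (_ + _).
Qed.

Lemma shiftK : cancel (linear_of shift_linear) (proj ext).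
Proof.
move=> a; rewrite /= /shift_fun raddfD /= secK.
by rewrite (proj_inc ext (beta a)) addr0.
Qed.

Let s' : section ext := Section shiftK.

Let EBl b := sesqBl (@lbr_sesq _ E) b.
Let EBr a := sesqBr (@lbr_sesq _ E) a.

Lemma shift_act_l : act_l s' = act_l s.
Proof.
apply/funext => a; apply/funext => h; apply: (@cmap_inc_inj _ _ _ _ ext).
rewrite !act_lE /= /shift_fun (zmorphD (EBl _)).
by rewrite (lbr_inc ext (beta a) h) addr0.
Qed.

Lemma shift_act_r : act_r s' = act_r s.
Proof.
apply/funext => h; apply/funext => a; apply: (@cmap_inc_inj _ _ _ _ ext).
rewrite !act_rE /= /shift_fun (zmorphD (EBr _)).
by rewrite (lbr_inc ext h (beta a)) addr0.
Qed.

Lemma shift_chi : delta1 s beta = chi s' - chi s.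
Proof.
apply/funext => a; apply/funext => b; rewrite !fctE.
apply: (@cmap_inc_inj _ _ _ _ ext).
have iB (u v : lpoly H) :
  cmap alphaL (u - v) = cmap alphaL u - cmap alphaL v by rewrite cmapD cmapN.
have e1 : cmap alphaL (act_l s a (beta b)) = lbr (s a) (alphaL (beta b)).
  exact: act_lE.
have e2 : cmap alphaL (act_r s (beta a) b) = lbr (alphaL (beta a)) (s b).
  exact: act_rE.
have e3 : cmap alphaL (chi s a b) = lbr (s a) (s b) - cmap s (lbr a b).
  exact: chiE.
have e4 : cmap alphaL (chi s' a b) =
    lbr (shift_fun a) (shift_fun b) - cmap shift_fun (lbr a b).
  exact: (chiE s').
have e5 : cmap shift_fun (lbr a b) =
    cmap s (lbr a b) + cmap alphaL (cmap beta (lbr a b)).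
  apply/malgP => k; rewrite mcoeffD cmap_comp ?raddf0 //.
  by rewrite !cmapE /= ?raddf0 // /shift_fun ?raddf0 ?addr0.
have e6 : lbr (shift_fun a) (shift_fun b) = lbr (s a) (s b)
    + (lbr (s a) (alphaL (beta b)) + lbr (alphaL (beta a)) (s b)).
  rewrite /shift_fun (zmorphD (EBr _)) !(zmorphD (EBl _) (s a)).
  by rewrite (lbr_inc ext (beta a) (beta b)) addr0 addrAC addrA.
have iD (u v : lpoly H) :
  cmap alphaL (u + v) = cmap alphaL u + cmap alphaL v by rewrite cmapD.
apply: (etrans (iB _ _)); rewrite iD e1 e2.
apply: (etrans _ (esym (iB (chi s' a b) (chi s a b)))); rewrite e3 e4 e5 e6.
have alg (V : zmodType) (X S c d : V) : S + X - (c + d) - (S - c) = X - d.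
  by rewrite opprD addrACA [S - c + _]addrC addrK.
by rewrite alg.
Qed.

Lemma delta1_cocycle : delta1 s beta \in is_cocycle s.
Proof.
have dE : delta2 s' = delta2 s by rewrite /delta2 shift_act_l shift_act_r.
have cs : chi s' \in is_cocycle s.
  have /asboolP[S1 D1] := chi_cocycle s'.
  apply/asboolP; split; first exact: S1.
  by move=> a b c; rewrite -dE; exact: D1.
rewrite shift_chi; exact: rpredB cs (chi_cocycle s).
Qed.

End ChangeOfSection.

(* Main.v *)
Require Import Defs.
From mathcomp Require Import all_boot all_algebra.
From mathcomp Require Import classical_sets reals complex.
From mathcomp Require Import boolp functions monalg.

(** The section identifies [E] with [H + s(R)] as a module, so an automorphism
    [f] preserving [H] and inducing [(gamma, phi)] is determined by a linear
    [beta : R -> H] with [f (s a) = s (phi a) + beta (phi a)].  Comparing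
    [f [s a, s b]] with [[f (s a), f (s b)]] shows that such an [f] preserves
    the bracket exactly when
    [gamma (chi (phi^-1 a, phi^-1 b)) - chi (a, b) = (delta beta) (a, b)]. *)

Set Implicit Arguments.
Unset Strict Implicit.
Unset Printing Implicit Defensive.

Import GRing.Theory.

Local Open Scope ring_scope.
Local Open Scope classical_set_scope.
Local Open Scope quotient_scope.

(** Bookkeeping for [bracket_defect]: [z] is the component along [s(R)], which both brackets share
    and which therefore cancels. *)
Lemma sub_common (V : zmodType) (u v w t z : V) :
  u + (z + w) - (t + (v + z)) = u - v - (t - w).
Proof.
rewrite [z + w]addrC !addrA opprD addrACA subrr addr0 opprB addrACA.
by rewrite -opprD [v + t]addrC.
Qed.

Section Wells.
Variables (C : fieldType) (R : lca C) (H : lmodType {poly C}) (E : lca C).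
Variables (ext : abelian_extension R H E) (s : section ext).

Local Notation alpha := (inc ext).
Local Notation p := (proj ext).

(** The projection of [E] onto [H] along [s(R)]. The argument of [inc_inv] lies in [ker p], so its
    default value never enters. *)
Definition retr (e : E) : H := inc_inv ext (e - s (p e)).

Lemma inc_retr e : alpha (retr e) = e - s (p e).
Proof. by apply: inc_invK; rewrite raddfB /= secK subrr. Qed.

Lemma retr_linear : linear retr.
Proof.
move=> k x y; apply: (@inc_inj _ _ _ _ ext).
by rewrite linearP !inc_retr !linearP /= addrACA -scalerDr.
Qed.

Lemma ext_decomp e : e = alpha (retr e) + s (p e).
Proof. by rewrite inc_retr subrK. Qed.

Lemma proj_decomp h a : p (alpha h + s a) = a.
Proof. by rewrite raddfD /= proj_inc add0r secK. Qed.

Lemma retr_decomp h a : retr (alpha h + s a) = h.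
Proof.
by apply: (@inc_inj _ _ _ _ ext); rewrite inc_retr proj_decomp addrK.
Qed.

Lemma lbrDl (A : lca C) (c : A) : {morph (@lbr _ A)^~ c : x y / x + y}.
Proof. exact: zmorphD (sesqBl (@lbr_sesq _ A) c). Qed.

Lemma lbrDr (A : lca C) (c : A) : {morph @lbr _ A c : x y / x + y}.
Proof. exact: zmorphD (sesqBr (@lbr_sesq _ A) c). Qed.

(** As [H] is abelian, [alpha h] and [alpha k] have zero bracket; the mixed brackets are the two
    actions. *)
Lemma lbr_decomp h a k b :
  lbr (alpha h + s a) (alpha k + s b) =
  cmap alpha (act_r s h b + act_l s a k) + lbr (s a) (s b).
Proof.
rewrite cmapD act_rE act_lE lbrDr !(lbrDl (alpha k)) !(lbrDl (s b)).
by rewrite lbr_inc add0r addrA [X in X + _]addrC.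
Qed.

Lemma cmap_incD (u v : lpoly H) :
  cmap alpha (u + v) = cmap alpha u + cmap alpha v.
Proof. exact: cmapD. Qed.

Lemma cmap_incB (u v : lpoly H) :
  cmap alpha (u - v) = cmap alpha u - cmap alpha v.
Proof. exact: cmapB (linear_zmorph (linearP alpha)) u v. Qed.

Section Induced.
Variables (gf : aut_pair s) (beta : {linear R -> H}) (f : {linear E -> E}).
Hypothesis f_inc : forall h, f (alpha h) = alpha (gf.1 h).
Hypothesis f_sec : forall a, f (s a) = s (gf.2 a) + alpha (beta (gf.2 a)).

Lemma cmap_induced_inc (u : lpoly H) :
  cmap f (cmap alpha u) = cmap alpha (cmap gf.1 u).
Proof.
have g0 := zmorph0 (linear_zmorph (mod_aut_linear gf.1)).
by rewrite !cmap_comp ?raddf0 //; apply: eq_cmap => x /=; rewrite f_inc.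
Qed.

(** Both brackets have the same component along [s(R)] because [gf.2] preserves the bracket of [R];
    only a difference in [H[lambda]] remains. *)
Lemma bracket_defect a b :
  cmap f (lbr (s a) (s b)) - lbr (f (s a)) (f (s b)) =
  cmap alpha (cmap gf.1 (chi s a b) - chi s (gf.2 a) (gf.2 b)
              - delta1 s beta (gf.2 a) (gf.2 b)).
Proof.
have phi0 := zmorph0 (linear_zmorph (lca_aut_linear gf.2)).
have sE : lbr (s a) (s b) = cmap alpha (chi s a b) + cmap s (lbr a b).
  by rewrite chiE subrK.
have fsE u : cmap f (cmap s u) =
    cmap s (cmap gf.2 u) + cmap alpha (cmap beta (cmap gf.2 u)).
  by apply/malgP => k; rewrite mcoeffD !cmapE ?raddf0 //=.
rewrite {1}sE (cmapD f) cmap_induced_inc fsE lca_aut_bracket !f_sec.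
rewrite ![s _ + _]addrC lbr_decomp /delta1.
have -> : lbr (s (gf.2 a)) (s (gf.2 b)) =
    cmap alpha (chi s (gf.2 a) (gf.2 b)) + cmap s (lbr (gf.2 a) (gf.2 b)).
  by rewrite chiE subrK.
set u := cmap gf.1 _; set v := chi _ _ _; set w := cmap beta _.
set x := act_r _ _ _; set y := act_l _ _ _; set z := cmap s _.
rewrite [y + x]addrC.
apply: (etrans _ (esym (cmap_incB (u - v) (x + y - w)))).
rewrite (cmap_incB u v) (cmap_incB (x + y) w).
exact: sub_common.
Qed.

(** By injectivity of [alpha], the equation on cochains says exactly that the defect vanishes on
    [s(R)]. *)
Lemma bracket_morphismP :
  bracket_morphism f <-> chi_twist s gf.1 gf.2 - chi s = delta1 s beta.
Proof.
have phiVK a : gf.2 ((gf.2^-1)%g a) = a by apply: symVK.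
have twE a b :
    chi_twist s gf.1 gf.2 (gf.2 a) (gf.2 b) = cmap gf.1 (chi s a b).
  by rewrite /chi_twist !symK.
split=> [fB|e].
  apply/funext => a; apply/funext => b; rewrite !fctE.
  (* Every argument is a value of [gf.2], which brings the equation to the form found in
     [bracket_defect]. *)
  rewrite -[a]phiVK -[b]phiVK twE; apply/eqP; rewrite -subr_eq0; apply/eqP.
  apply: (@cmap_inc_inj _ _ _ _ ext); rewrite -bracket_defect fB subrr.
  by rewrite /cmap mfold0.
have fBs a b : cmap f (lbr (s a) (s b)) = lbr (f (s a)) (f (s b)).
  apply/eqP; rewrite -subr_eq0 bracket_defect -twE -e !fctE subrr.
  by rewrite /cmap mfold0.
(* Compatibility of the pair settles the mixed brackets; there the [beta] terms only meet elements
   of the abelian [H]. *)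
have /asboolP[cl cr] := aut_pairP gf.
move=> x y; rewrite (ext_decomp x) (ext_decomp y) lbr_decomp (cmapD f) fBs.
rewrite cmap_induced_inc (zmorphD (cmapB (linear_zmorph (mod_aut_linear gf.1)))).
rewrite cl cr.
rewrite !(raddfD f) /= !f_inc !f_sec ![s _ + alpha _]addrC !addrA -!(raddfD alpha).
rewrite !lbr_decomp (zmorphD (act_lB s _)) (zmorphD (act_rB s _) (gf.1 _)).
apply: (etrans (addrA _ _ _)); apply: (congr1 (fun w => w + _)).
apply: (etrans (esym (cmap_incD _ _))).
exact: (congr1 (cmap alpha) (addrACA _ _ _ _)).
Qed.

End Induced.

Lemma wells_eq0 (gf : aut_pair s) :
  wells s gf = 0 <->
  exists beta : {linear R -> H}, chi_twist s gf.1 gf.2 - chi s = delta1 s beta.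
Proof.
(* With 0 written as the class of 0, equality in the quotient becomes membership of the difference
   in the coboundaries. *)
rewrite -[X in _ = X](@raddf0 _ _ (\pi_(H2 s))) /wells; split.
  move/eqP; rewrite -Quotient.idealrBE subr0 => /asboolP[beta e].
  by exists beta.
move=> [beta e]; apply/eqP; rewrite -Quotient.idealrBE subr0.
by apply/asboolP; exists beta.
Qed.

Lemma wells_kappa (f : autH ext) : wells s (kappa s f) = 0.
Proof.
pose hatV : sym R := ((kappa s f).2^-1)%g.
have hatVK a : hat s f (hatV a) = a.
  exact: (symVK (kappa s f).2 a).
(* The condition [f_sec] at [hatV a] forces this value of the cochain; it lies in [ker p] since
   [hatV] inverts [hat s f]. *)
have betaE a : alpha (inc_inv ext (f (s (hatV a)) - s a)) = f (s (hatV a)) - s a.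
  by apply: inc_invK; rewrite raddfB /= secK -[X in _ - X]hatVK subrr.
have hatVL : linear hatV by exact: (lca_aut_linear (kappa s f).2^-1%g).
pose b a := inc_inv ext (f (s (hatV a)) - s a).
have bL : linear b.
  move=> k x y; apply: (@inc_inj _ _ _ _ ext).
  rewrite linearP /b !betaE hatVL !(linearP s) lca_aut_linear.
  by rewrite opprD addrACA scalerBr.
apply/wells_eq0; exists (linear_of bL).
apply/(bracket_morphismP (f := linear_of (lca_aut_linear f))).
- by move=> h /=; rewrite autH_inc.
- move=> a /=; rewrite /b betaE.
  by rewrite [hatV _](symK (kappa s f).2) addrC subrK.
- exact: lca_aut_bracket.
Qed.

(** A cochain bounding the Wells cocycle supplies the component from [s(R)] to [H] that the pair
    leaves open. *)
Lemma wells_lift (gf : aut_pair s) :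
  wells s gf = 0 -> exists f : autH ext, kappa s f = gf.
Proof.
move=> /wells_eq0[beta e].
have gL := mod_aut_linear gf.1; have phiL := lca_aut_linear gf.2.
(* The only additive map satisfying [f_inc] and [f_sec], by [ext_decomp]. *)
pose F x := alpha (gf.1 (retr x)) + alpha (beta (gf.2 (p x))) + s (gf.2 (p x)).
have FL : linear F.
  move=> k x y; rewrite /F retr_linear gL !(linearP p) phiL !linearP /=.
  rewrite !scalerDr [X in X + _ = _]addrACA.
  exact: (addrACA (_ + _)).
have F_inc h : F (alpha h) = alpha (gf.1 h).
  rewrite /F proj_inc (zmorph0 (linear_zmorph phiL)) !raddf0 !addr0.
  by rewrite -[alpha h]addr0 -(raddf0 s) retr_decomp.
have F_sec a : F (s a) = s (gf.2 a) + alpha (beta (gf.2 a)).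
  rewrite /F secK -{1}[s a]add0r -(raddf0 alpha) retr_decomp.
  by rewrite (zmorph0 (linear_zmorph gL)) raddf0 add0r addrC.
have FB : bracket_morphism F.
  exact: (proj2 (bracket_morphismP (f := linear_of FL) F_inc F_sec) e).
(* [F] is triangular for [H + s(R)]: solve for the [R] component first, then remove [beta] of it
   from the [H] component. *)
pose G x := alpha ((gf.1^-1)%g (retr x - beta (p x))) + s ((gf.2^-1)%g (p x)).
have Fbij : `[< bijective F >].
  apply/asboolP; exists G => x.
    rewrite /F -raddfD /G retr_decomp proj_decomp addrK !symK.
    by rewrite -ext_decomp.
  rewrite /F {1 2 3}/G retr_decomp proj_decomp !symVK -raddfD subrK.
  by rewrite -ext_decomp.
have Faut : Sym Fbij \in @is_lca_aut _ E by apply/asboolP.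
have FH : LcaAut Faut \in preserves_H ext.
  apply/asboolP/seteqP; split=> [_ [_ [h _ <-] <-]|_ [h _ <-]] /=.
    by rewrite F_inc; exists (gf.1 h).
  exists (alpha ((gf.1^-1)%g h)); first by exists ((gf.1^-1)%g h).
  by rewrite F_inc symVK.
exists (AutH FH); apply/val_inj; rewrite [RHS]surjective_pairing.
congr (_, _); apply/val_inj/symP => x.
  by rewrite -[LHS]/(inc_inv ext (F (alpha x))) F_inc incK.
by rewrite -[LHS]/(p (F (s x))) F_sec raddfD /= proj_inc addr0 secK.
Qed.

(** Gives exactness at [autH]: the components of [kappa s f] are the restriction and [hat s f] by
    definition. *)
Lemma kappa_eq1 (f : autH ext) : kappa s f = 1%g <-> f \in induces_id s.
Proof.
split=> [e|/asboolP[fr fh]].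
  apply/asboolP; split; apply/funext => x.
    by rewrite -[LHS]/((kappa s f).1 x) e.
  by rewrite -[LHS]/((kappa s f).2 x) e.
apply/val_inj; congr (_, _); apply/val_inj/symP => x /=.
  by rewrite fr.
by rewrite fh.
Qed.

End Wells.

Theorem corollary5p7 (K : realType) (R : lca K[i])
    (H : lmodType {poly K[i]}) (E : lca K[i])
    (ext : abelian_extension R H E) (s : section ext)
    (fgR : finitely_generated R) (fgH : finitely_generated H)
    (fgE : finitely_generated E) :
  [/\ iota_idH s @^-1` [set 1%g] = [set 1%g],
      range (iota_idH s) = kappa s @^-1` [set 1%g]
    & range (kappa s) = wells s @^-1` [set 0] ].
Proof.
split; apply/seteqP; split=> [x /= e|x /= e].
(* [iota_idH] is a subtype inclusion, hence injective. *)
- exact/val_inj.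
- by rewrite e.
- by case: e => f _ <-; apply/kappa_eq1/aut_idHP.
- by have /kappa_eq1 fid := e; exists (AutIdH fid).
- by case: e => f _ <-; apply: wells_kappa.
- by have [f <-] := wells_lift e; exists f.
Qed.
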